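(* Let $\alpha\ge 0$, $\mu>-\frac12$, $\lambda\ge 0$, and let $g:[0,\infty)\to\mathbb{R}$ be uniformly continuous. Then for every $n\in\mathbb{N}$ and every $x\in[0,\infty)$, $$\left|\mathcal{S}_n(g;x)-g(x)\right|\le\left(1+\sqrt{\frac{x^2}{n}\left(4x^2\alpha^2+4\lambda\alpha+10\alpha\right)+2x\left(\mu\frac{e_\mu(-nx)}{e_\mu(nx)}+1\right)+\frac{(\lambda+1)(\lambda+2)}{n}}\,\right)\omega\left(g;\frac{1}{\sqrt n}\right),$$ where $\omega(g;\delta)=\sup\{|g(s)-g(t)|:\ s,t\in[0,\infty),\ |s-t|\le\delta\}$ is the modulus of continuity.
   Context: $\mathbb{N}=\{1,2,3,\dots\}$, $\mathbb{N}_0=\mathbb{N}\cup\{0\}$, and $\Gamma$ is the Gamma function. For $\mu>-\frac12$ and $k\in\mathbb{N}_0$ put $$\gamma_\mu(2k)=\frac{2^{2k}k!\,\Gamma(k+\mu+\frac12)}{\Gamma(\mu+\frac12)},\qquad \gamma_\mu(2k+1)=\frac{2^{2k+1}k!\,\Gamma(k+\mu+\frac32)}{\Gamma(\mu+\frac12)},$$ and let $\theta_k=0$ if $k$ is even, $\theta_k=1$ if $k$ is odd. The Dunkl exponential function is $e_\mu(x)=\sum_{k=0}^\infty \frac{x^k}{\gamma_\mu(k)}$. The Dunkl generalization of the two-variable Hermite polynomials is $$h_k^\mu(\xi,\alpha)=\gamma_\mu(k)\sum_{j=0}^{\lfloor k/2\rfloor}\frac{\alpha^j\xi^{k-2j}}{j!\,\gamma_\mu(k-2j)},$$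 equivalently $\sum_{k=0}^\infty \frac{h_k^\mu(\xi,\alpha)}{\gamma_\mu(k)}t^k=e^{\alpha t^2}e_\mu(\xi t)$. For $\alpha\ge0$, $\mu>-\frac12$, $\lambda\ge0$, $n\in\mathbb{N}$, $x\in[0,\infty)$ and functions $f$ on $[0,\infty)$ for which the right-hand side makes sense, define $$\mathcal{S}_n(f;x)=\frac{1}{e^{\alpha x^2}e_\mu(nx)}\sum_{k=0}^\infty\frac{h_k^\mu(n,\alpha)}{\gamma_\mu(k)}x^k\,\frac{n^{k+2\mu\theta_k+\lambda+1}}{\Gamma(k+2\mu\theta_k+\lambda+1)}\int_0^\infty t^{k+2\mu\theta_k+\lambda}e^{-nt}f(t)\,dt.$$ *)

(* Defs.v *)
From HB Require Import structures.
From mathcomp Require Import all_boot all_order all_algebra.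
From mathcomp Require Import all_classical all_reals all_analysis.

Set Implicit Arguments.
Unset Strict Implicit.
Unset Printing Implicit Defensive.

Import Order.TTheory GRing.Theory Num.Theory.
Import numFieldNormedType.Exports.

Local Open Scope classical_set_scope.
Local Open Scope ring_scope.

(* Euler's integral, used for s > 0 only.  The value 0 `^ a at the endpoint is
   a convention of powR; it is irrelevant, [set 0] being a null set. *)
Definition Gamma {R : realType} (s : R) : R :=
  \int[@lebesgue_measure R]_(t in `[0, +oo[) (t `^ (s - 1) * expR (- t)).

(* The m in the classical formulas for k = 2 m and k = 2 m + 1 is k./2. *)
Definition dunkl_gamma {R : realType} (mu : R) (k : nat) : R :=
  if odd k then
    2 ^+ k * (k./2)`!%:R * Gamma ((k./2)%:R + mu + 3 / 2) / Gamma (mu + 1 / 2)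
  else
    2 ^+ k * (k./2)`!%:R * Gamma ((k./2)%:R + mu + 1 / 2) / Gamma (mu + 1 / 2).

Definition theta {R : realType} (k : nat) : R := if odd k then 1 else 0.

Definition dunkl_exp {R : realType} (mu x : R) : R :=
  limn (series (fun k : nat => x ^+ k / dunkl_gamma mu k)).

Definition dunkl_hermite {R : realType} (mu : R) (k : nat) (xi alpha : R) : R :=
  dunkl_gamma mu k *
  \sum_(0 <= j < (k./2).+1)
    (alpha ^+ j * xi ^+ (k - 2 * j) / (j`!%:R * dunkl_gamma mu (k - 2 * j))).

(* Only the values of f on [0, +oo[ matter. *)
Definition szasz_gamma {R : realType} (alpha mu lambda : R) (n : nat)
    (f : R -> R) (x : R) : R :=
  (expR (alpha * x ^+ 2) * dunkl_exp mu (n%:R * x))^-1 *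
  limn (series (fun k : nat =>
    dunkl_hermite mu k n%:R alpha / dunkl_gamma mu k * x ^+ k *
    (n%:R `^ (k%:R + 2 * mu * theta k + lambda + 1)
       / Gamma (k%:R + 2 * mu * theta k + lambda + 1)) *
    \int[@lebesgue_measure R]_(t in `[0, +oo[)
      (t `^ (k%:R + 2 * mu * theta k + lambda) * expR (- (n%:R * t)) * f t))).

(* Modulus of continuity of f on [0, +oo[.  The supremum is taken in R; the set
   is nonempty for d >= 0, and bounded when f is uniformly continuous. *)
Definition omega {R : realType} (f : R -> R) (d : R) : R :=
  sup [set r : R | exists s t : R,
         [/\ 0 <= s, 0 <= t, `|s - t| <= d & r = `|f s - f t|]].

(* Main.v *)
(* S_n(f; x) is the mean, for nonnegative weights w_k, of Gamma means of f with
   shape parameters B_k + lambda + 1, where B_k = k + 2 mu theta_k.  The weights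
   are a convolution of the coefficients of e^{alpha x^2}, in which the index
   counts double, with those of e_mu(n x).  Since B_{2j+m} = 2j + B_m and
   gamma_mu(k+1) = B_{k+1} gamma_mu(k), the moments of B_k are computed in
   closed form, and n times the second moment of the operator about x is exactly
   the radicand M.  As |g(t) - g(x)| <= (1 + sqrt(n) |t - x|) omega(1/sqrt(n)),
   the inequality 2 sqrt(n) |t - x| <= c + n (t - x)^2 / c, used for each
   c > sqrt(M), replaces the Cauchy-Schwarz inequality; then c -> sqrt(M). *)

Require Import Defs.
From HB Require Import structures.
From mathcomp Require Import all_boot all_order all_algebra.
From mathcomp Require Import all_classical all_reals all_analysis.
From mathcomp Require Import measurable_realfun.
From mathcomp Require Import ring lra zify.

Import Order.TTheory GRing.Theory Num.Theory.
Import numFieldNormedType.Exports.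

Local Open Scope classical_set_scope.
Local Open Scope ring_scope.

(** * The Gamma function *)

Lemma itv0y_bigcup (R : realType) :
  `]0, +oo[%classic = \bigcup_m `[m.+1%:R^-1, m.+2%:R]%classic :> set R.
Proof.
apply/seteqP; split => [t /=|t [m _] /=]; rewrite !in_itv/= andbT.
(* Taking the maximum of t and 1/t lets one index control both endpoints. *)
- move=> t0; pose m := Num.truncn (Num.max t t^-1).
  have tm : Num.max t t^-1 < m.+1%:R by exact: truncnS_gt.
  move: tm; rewrite gt_max => /andP[tm1 tm2].
  exists m => //=; rewrite in_itv/= invf_ple ?posrE// (ltW tm2)/=.
  by rewrite (le_trans (ltW tm1))// ler_nat.
- by case/andP => + _; apply: lt_le_trans; rewrite invr_gt0.
Qed.

(* Both sides may be +oo: applied to the Gamma integrals, this gives the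
   functional equation before their convergence is known. *)
Lemma ge0_integral_eq_derive (R : realType) (F f1 f2 : R -> R) :
    (forall t : R, 0 < t -> {for t, continuous f1}) ->
    (forall t : R, 0 < t -> {for t, continuous f2}) ->
    (forall t : R, 0 < t -> 0 <= f1 t) -> (forall t : R, 0 < t -> 0 <= f2 t) ->
    (forall t : R, 0 < t -> is_derive t 1 F (f1 t - f2 t)) ->
    F t @[t --> 0^'+] --> 0 -> F t @[t --> +oo] --> 0 ->
  (\int[@lebesgue_measure R]_(t in `]0%R, +oo[) (f1 t)%:E =
   \int[@lebesgue_measure R]_(t in `]0%R, +oo[) (f2 t)%:E)%E.
Proof.
move=> cf1 cf2 f10 f20 dF F0 Foo.
pose A (m : nat) : set R := `[m.+1%:R^-1, m.+2%:R]%classic.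
have A_gt0 m t : A m t -> 0 < t.
  by rewrite /A/= in_itv/= => /andP[+ _]; apply: lt_le_trans; rewrite invr_gt0.
have ndA : nondecreasing_seq A.
  move=> m p mp; apply/subsetPset => t; rewrite /A/= !in_itv/= => /andP[mt tm].
  rewrite (le_trans _ mt) ?(le_trans tm) ?ler_nat//.
  by rewrite lef_pV2 ?posrE// ler_nat.
have wc (f : R -> R) m : (forall t : R, 0 < t -> {for t, continuous f}) ->
    {within A m, continuous f}.
  by move=> cf; apply: continuous_in_subspaceT => t /set_mem /A_gt0; exact: cf.
have itf (f : R -> R) m : (forall t : R, 0 < t -> {for t, continuous f}) ->
    (@lebesgue_measure R).-integrable (A m) (EFin \o f).
  by move=> cf; apply: continuous_compact_integrable;
    [exact: segment_compact|exact: wc].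
have cvgA (f : R -> R) : (forall t : R, 0 < t -> {for t, continuous f}) ->
    (forall t : R, 0 < t -> 0 <= f t) ->
    (\int[@lebesgue_measure R]_(t in A m) (f t)%:E)%E @[m --> \oo] -->
    (\int[@lebesgue_measure R]_(t in `]0%R, +oo[) (f t)%:E)%E.
  move=> cf f0; rewrite itv0y_bigcup.
  apply: ge0_nondecreasing_set_cvg_integral => //.
  - by move=> m; exact: measurable_itv.
  - by move=> m; exact: (measurable_int _ (itf _ _ cf)).
  - by move=> m t /A_gt0 /f0; rewrite lee_fin.
(* On a compact piece both integrals are finite and the fundamental theorem of calculus applies. The
   increment of F stands on the right as a finite summand, so the limit never subtracts two infinite
   integrals. *)
have EA m : (\int[@lebesgue_measure R]_(t in A m) (f1 t)%:E =
    \int[@lebesgue_measure R]_(t in A m) (f2 t)%:E +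
    (F m.+2%:R - F m.+1%:R^-1)%:E)%E.
  have := @continuous_FTC2 R (f1 \- f2) F m.+1%:R^-1 m.+2%:R.
  rewrite -EFinB => <-.
  - rewrite -/(A m); under [X in _ = (_ + X)%E]eq_integral do rewrite EFinB.
    rewrite integralB//=; [|exact: measurable_itv|exact: itf|exact: itf].
    rewrite addeCA subee ?adde0//.
    by apply: integrable_fin_num; [exact: measurable_itv|exact: itf].
  - by rewrite (@le_lt_trans _ _ 1) ?ltr1n// invf_le1// ler1n.
  - by apply: wc => t t0; apply: continuousB; [exact: cf1|exact: cf2].
  - have cF t : 0 < t -> {for t, continuous F}.
      by move=> /dF ?; apply: differentiable_continuous; exact/derivable1_diffP.
    split.
    + move=> t; rewrite in_itv/= => /andP[mt _].
      have t0 : 0 < t by apply: lt_trans mt; rewrite invr_gt0.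
      exact: (@ex_derive _ _ _ _ _ _ _ (dF _ t0)).
    + by apply/cvg_at_right_filter/cF; rewrite invr_gt0.
    + exact/cvg_at_left_filter/cF.
  - move=> t; rewrite in_itv/= => /andP[mt _].
    have t0 : 0 < t by apply: lt_trans mt; rewrite invr_gt0.
    have ? := dF _ t0.
    by rewrite derive1E derive_val.
suff: (\int[@lebesgue_measure R]_(t in A m) (f1 t)%:E)%E @[m --> \oo] -->
    (\int[@lebesgue_measure R]_(t in `]0%R, +oo[) (f2 t)%:E + (0 - 0)%:E)%E.
  by rewrite subr0 adde0; apply: cvg_unique => //; exact: cvgA.
under eq_fun do rewrite EA.
apply: cvgeD; first by rewrite fin_num_adde_defl.
- exact: cvgA.
- apply: cvg_EFin; first exact: nearW.
  apply: cvgB.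
  + move/cvg_pinftyP : Foo; apply.
    by have := @cvgr_idn R; rewrite -cvg_shiftS -cvg_shiftS.
  + have /cvg_at_rightP := F0; apply; split; first by move=> k; rewrite invr_gt0.
    exact: cvg_harmonic.
Unshelve. all: end_near. Qed.

Lemma cvg_powR_expRN (R : realType) (s : R) :
  t `^ s * expR (- t) @[t --> +oo] --> 0.
Proof.
have [N sN] : exists N : nat, s <= N%:R.
  by exists (Num.truncn s).+1; rewrite ltW// truncnS_gt.
apply: (@squeeze_cvgr _ _ _ _ (cst 0) (fun t : R => N.+1`!%:R * t^-1)).
- near=> t.
  have t1 : 1 <= t by near: t; exact: nbhs_pinfty_ge.
  have t0 : 0 < t by exact: lt_le_trans t1.
  rewrite mulr_ge0 ?powR_ge0 ?expR_ge0//=.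
  have tsN : t `^ s <= t ^+ N.
    by rewrite -powR_mulrn ?(ltW t0)// ler_powR.
  rewrite expRN ler_pdivrMr ?expR_gt0// (le_trans tsN)//.
  have f0 : 0 < N.+1`!%:R :> R by rewrite ltr0n fact_gt0.
  rewrite mulrAC ler_pdivlMr// mulrC -exprS -ler_pdivrMl// mulrC.
  by apply: le_trans (expR_ge1Dxn N (ltW t0)); rewrite lerDr.
- exact: cvg_cst.
- rewrite -[X in _ --> X](mulr0 N.+1`!%:R); apply: cvgMl_tmp.
  apply/gtr0_cvgV0; last exact: cvg_id.
  by near=> t; near: t; exact: nbhs_pinfty_gt.
Unshelve. all: end_near. Qed.

Section Gamma.
Context {R : realType}.
Notation mu := (@lebesgue_measure R).
Implicit Types s t : R.

Let I s := (\int[mu]_(t in `[0%R, +oo[) (t `^ (s - 1) * expR (- t))%:E)%E.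

Let mI s (D : set R) : measurable_fun D (fun t => (t `^ (s - 1) * expR (- t))%:E).
Proof.
apply/measurable_EFinP/measurable_funM; first exact: measurable_funTS.
by apply: measurable_funTS; apply: measurableT_comp => //; exact: measurable_funN.
Qed.

Let cI s t : 0 < t -> {for t, continuous (fun t => t `^ s * expR (- t))}.
Proof.
move=> t0; apply: continuousM.
  apply: differentiable_continuous; apply/derivable1_diffP.
  by apply: derivable_powR; rewrite in_itv/= t0.
apply: continuous_comp; first exact: opp_continuous.
exact: continuous_expR.
Qed.

(** Integration by parts with boundary function t^s e^(-t), stated in the extended reals so that
    finiteness can be deduced from it afterwards. The endpoint 0 is removed first, continuity being
    available for t > 0 only. *)
Let IS s : 0 < s -> (s%:E * I s = I (s + 1))%E.
Proof.
move=> s0; rewrite /I -ge0_integralZl//; last 3 first.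
- exact: mI.
- by move=> t _; rewrite lee_fin mulr_ge0 ?powR_ge0 ?expR_ge0.
- by rewrite lee_fin ltW.
under eq_integral do rewrite -EFinM.
rewrite addrK -!integral_itv_obnd_cbnd; last 2 first.
- by have := mI (s + 1) `]0%R, +oo[%classic; rewrite addrK.
- by apply/measurable_EFinP/measurable_funM => //; apply/measurable_EFinP; exact: mI.
apply: (@ge0_integral_eq_derive _ (fun t => t `^ s * expR (- t))
  (fun t => s * (t `^ (s - 1) * expR (- t))) (fun t => t `^ s * expR (- t))).
- by move=> t t0; apply: continuousM; [exact: cst_continuous|exact: cI].
- by move=> t t0; exact: cI.
- by move=> t t0; rewrite mulr_ge0 ?mulr_ge0 ?powR_ge0 ?expR_ge0 ?(ltW s0).
- by move=> t t0; rewrite mulr_ge0 ?powR_ge0 ?expR_ge0.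
- move=> t t0; have D1 := is_derive1_powR s t0.
  have D2 : is_derive t 1 (fun t => expR (- t)) (- expR (- t)).
    by apply: is_derive_eq; rewrite /GRing.scale/=; ring.
  by apply: is_derive_eq (is_deriveM D1 D2) _; rewrite /GRing.scale/=; ring.
- rewrite -[X in _ --> X](mul0r (expR (- 0))); apply: cvgM; first exact: powR_cvg0.
  apply: cvg_at_right_filter; apply: continuous_comp; first exact: opp_continuous.
  exact: continuous_expR.
- exact: cvg_powR_expRN.
Qed.

Let I1 : I 1 = 1%E.
Proof.
rewrite /I; under eq_integral do rewrite subrr powRr0 mul1r.
have cE : continuous (fun t : R => expR (- t)).
  move=> t; apply: continuous_comp; first exact: opp_continuous.
  exact: continuous_expR.
rewrite (@ge0_continuous_FTC2y _ (fun t => expR (- t)) (fun t => - expR (- t)) _ 0).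
- by rewrite oppr0 expR0 sub0e EFinN oppeK.
- by move=> t _; exact: expR_ge0.
- exact: continuous_subspaceT.
- by rewrite -[X in _ --> X]oppr0; apply: cvgN; exact: cvgr_expR.
- by move=> t _; apply: ex_derive.
- by apply: cvg_at_right_filter; apply: cvgN; exact: cE.
- by move=> t _; rewrite derive1E derive_val /GRing.scale/=; ring.
Qed.

Let I_ge0 s : (0 <= I s)%E.
Proof. by apply: integral_ge0 => t _; rewrite lee_fin mulr_ge0 ?powR_ge0 ?expR_ge0. Qed.

Let I_natS n : (I n.+1%:R < +oo)%E.
Proof.
elim: n => [|n IHn]; first by rewrite I1 ltry.
rewrite -natr1 -IS//; have : I n.+1%:R \is a fin_num by rewrite ge0_fin_numE.
by move=> /fineK <-; rewrite -EFinM ltry.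
Qed.

(** For a natural N >= s, t^s <= 1 + t^N on the half-line, by cases on t <= 1; the right side
    integrates to the known values at 1 and N + 1. *)
Let IS_lty s : 0 < s -> (I (s + 1) < +oo)%E.
Proof.
move=> s0; have [N sN] : exists N : nat, s <= N%:R.
  by exists (Num.truncn s).+1; rewrite ltW// truncnS_gt.
apply: (@le_lt_trans _ _ (I 1 + I N.+1%:R)%E); last by rewrite I1 lte_add_pinfty ?ltry ?I_natS.
rewrite /I -ge0_integralD//; last 4 first.
- by move=> t _; rewrite lee_fin mulr_ge0 ?powR_ge0 ?expR_ge0.
- exact: mI.
- by move=> t _; rewrite lee_fin mulr_ge0 ?powR_ge0 ?expR_ge0.
- exact: mI.
apply: ge0_le_integral => //.
- by move=> t _; rewrite lee_fin mulr_ge0 ?powR_ge0 ?expR_ge0.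
- exact: mI.
- by apply: emeasurable_funD; exact: mI.
- move=> t /=; rewrite in_itv/= andbT => t0; rewrite -EFinD lee_fin -mulrDl.
  rewrite ler_wpM2r ?expR_ge0// addrK subrr powRr0 -natr1 addrK.
  have [t1|t1] := leP t 1.
    rewrite (@le_trans _ _ 1) ?lerDl ?powR_ge0//.
    have <- : 1 `^ s = 1 :> R by rewrite powR1.
    by rewrite ge0_ler_powR ?nnegrE// ltW.
  by rewrite ler_wpDl// ler_powR ?(ltW t1).
Qed.

(** On [1, 2] the integrand is at least e^(-2). *)
Let IS_gt0 s : 0 < s -> (0 < I (s + 1))%E.
Proof.
move=> s0; apply: (@lt_le_trans _ _ (\int[mu]_(t in `[1%R, 2%R]) (expR (- 2))%:E)%E).
  rewrite integral_cst//= lebesgue_measure_itv/= lte_fin ltr1n/=.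
  by rewrite -EFinD -EFinM lte_fin mulr_gt0 ?expR_gt0//; lra.
apply: (@le_trans _ _ (\int[mu]_(t in `[1%R, 2%R]) (t `^ (s + 1 - 1) * expR (- t))%:E)%E).
  apply: ge0_le_integral => //.
  - exact: mI.
  - move=> t /=; rewrite in_itv/= => /andP[t1 t2]; rewrite lee_fin addrK.
    rewrite -[leLHS]mul1r ler_pM ?expR_ge0 ?ler_expR ?lerN2//.
    by rewrite -(powRr0 t) ler_powR// ltW.
apply: ge0_subset_integral => //.
- exact: mI.
- by move=> t _; rewrite lee_fin mulr_ge0 ?powR_ge0 ?expR_ge0.
- by move=> t /=; rewrite !in_itv/= andbT => /andP[t1 _]; exact: le_trans t1.
Qed.

(** The functional equation carries finiteness from s + 1 down to s: an infinite [I s] would make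
    [I (s + 1)] infinite. No separate estimate near the singularity at 0 is made. *)
Let I_fin s : 0 < s -> I s \is a fin_num.
Proof.
move=> s0; rewrite ge0_fin_numE//; have := IS_lty _ s0; rewrite -IS//.
by have := I_ge0 s; case: (I s) => [r|_|//]; rewrite ?ltry// gt0_muley// lte_fin.
Qed.

Lemma GammaS s : 0 < s -> Gamma (s + 1) = s * Gamma s.
Proof.
move=> s0; rewrite /Gamma /Rintegral -/(I s) -/(I (s + 1)) -IS//.
by rewrite fineM// I_fin.
Qed.

Lemma Gamma_gt0 s : 0 < s -> 0 < Gamma s.
Proof.
move=> s0; have : 0 < Gamma (s + 1).
  rewrite /Gamma /Rintegral -/(I (s + 1)) fine_gt0//.
  by rewrite IS_gt0//= IS_lty.
by rewrite GammaS// pmulr_rgt0.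
Qed.

Lemma EFin_Gamma s : 0 < s ->
  (Gamma s)%:E = (\int[mu]_(t in `[0%R, +oo[) (t `^ (s - 1) * expR (- t))%:E)%E.
Proof. by move=> s0; rewrite fineK// I_fin. Qed.

End Gamma.

(** * Means against Gamma densities *)

Section gamma_kernel.
Context {R : realType}.
Notation mu := (@lebesgue_measure R).
Notation D := (`[0%R, +oo[%classic : set R).
Implicit Types a c t : R.

Lemma gamma_integral a c : 0 <= a -> 0 < c ->
  (\int[mu]_(t in `[0%R, +oo[) (t `^ a * expR (- (c * t)))%:E =
   (Gamma (a + 1) / c `^ (a + 1))%:E)%E.
Proof.
move=> a0 c0.
have ca0 : c `^ (a + 1) != 0 by rewrite gt_eqF// powR_gt0.
have dc : derive1 (fun t => c * t) = cst c.
  by apply/funext => t; rewrite derive1Ml// derive1_id mulr1.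
have ce : continuous (fun t => expR (- t)).
  move=> t; apply: continuous_comp; first exact: opp_continuous.
  exact: continuous_expR.
have := @increasing_ge0_integration_by_substitutiony R (fun t => c * t)
  (fun t => t `^ a * expR (- t)) 0.
rewrite dc mulr0 => subst.
have {subst}IG : (\int[mu]_(t in `[0%R, +oo[) (t `^ a * expR (- t))%:E =
    (c `^ (a + 1))%:E *
    \int[mu]_(t in `[0%R, +oo[) (t `^ a * expR (- (c * t)))%:E)%E.
  rewrite subst; last 8 first.
  - by move=> s t _ _ st; rewrite ltr_pM2l.
  - by move=> t _; exact: cst_continuous.
  - exact: is_cvg_cst.
  - exact: is_cvg_cst.
  - split; first by move=> t _; exact: derivableM.
    apply: cvg_at_right_filter; apply: cvgM; [exact: cvg_cst|exact: cvg_id].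
  - by apply: gt0_cvgMry; [exact: c0|exact: cvg_id].
  - apply/continuous_within_itvcyP; split.
      move=> t; rewrite in_itv/= andbT => t0; apply: cvgM; last exact: ce.
      suff : {for t, continuous (fun s => s `^ a)} by [].
      apply: differentiable_continuous; apply/derivable1_diffP.
      by apply: derivable_powR; rewrite in_itv/= t0.
    apply: cvgM; last by apply: cvg_at_right_filter; exact: ce.
    (* Right continuity of t^a at 0: for a = 0 the function is constantly 1, including at 0 by the
       convention of [powR]; for a > 0 both the value and the limit are 0. *)
    have [->|an0] := eqVneq a 0.
      by under eq_fun do rewrite powRr0; rewrite powRr0; exact: cvg_cst.
    by rewrite powR0//; apply: powR_cvg0; rewrite lt_neqAle eq_sym an0.
  - by move=> t _; rewrite mulr_ge0 ?powR_ge0 ?expR_ge0.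
  rewrite -ge0_integralZl//; last 3 first.
  - apply/measurable_EFinP/measurable_funM; first exact: measurable_funTS.
    apply: measurable_funTS; apply: measurableT_comp => //.
    by apply: measurableT_comp => //; exact: measurable_funM.
  - by move=> t _; rewrite lee_fin mulr_ge0 ?powR_ge0 ?expR_ge0.
  - by rewrite lee_fin powR_ge0.
  apply: eq_integral => t; rewrite inE/= in_itv/= andbT => t0.
  rewrite -EFinM; congr EFin; rewrite !fctE/=.
  rewrite powRM ?(ltW c0)// powRD ?(gt_eqF c0) ?implybT// powRr1 ?(ltW c0)//=.
  by ring.
have := @EFin_Gamma R _ (ltr_wpDl a0 ltr01); rewrite addrK IG => EG.
by rewrite mulrC EFinM EG muleA -EFinM mulVf// mul1e.
Qed.

Lemma measurable_gamma_kernel a c (D : set R) :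
  measurable_fun D (fun t => t `^ a * expR (- (c * t))).
Proof.
apply: measurable_funM; first exact: measurable_funTS.
apply: measurable_funTS; apply: measurableT_comp => //.
by apply: measurableT_comp => //; exact: measurable_funM.
Qed.

Lemma integrable_gamma_kernel a c : 0 <= a -> 0 < c ->
  mu.-integrable D (EFin \o (fun t => t `^ a * expR (- (c * t)))).
Proof.
move=> a0 c0; apply/integrableP; split.
  by apply/measurable_EFinP; exact: measurable_gamma_kernel.
under eq_integral => t _ do
  rewrite /= ger0_norm ?mulr_ge0 ?powR_ge0 ?expR_ge0//.
by rewrite gamma_integral// ltry.
Qed.

Lemma Rintegral_gamma_kernel a c : 0 <= a -> 0 < c ->
  \int[mu]_(t in `[0, +oo[) (t `^ a * expR (- (c * t))) =
  Gamma (a + 1) / c `^ (a + 1).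
Proof. by move=> a0 c0; rewrite /Rintegral gamma_integral. Qed.

Lemma gamma_kernelS a c t : 0 <= a -> 0 <= t ->
  t `^ (a + 1) * expR (- (c * t)) = t `^ a * expR (- (c * t)) * t.
Proof.
move=> a0 t0; rewrite -(mulr_powRB1 t0 (ltr_wpDl a0 ltr01)) addrK; ring.
Qed.

Let integrable_add (f g : R -> R) :
  mu.-integrable D (EFin \o f) -> mu.-integrable D (EFin \o g) ->
  mu.-integrable D (EFin \o (fun t => f t + g t)).
Proof.
move=> intf intg.
rewrite (_ : _ \o _ = (EFin \o f) \+ (EFin \o g))%E; last exact/funext.
exact: integrableD.
Qed.

(** The expectation of f under the Gamma distribution with shape a + 1 and rate c. *)
Definition gamma_mean a c (f : R -> R) : R :=
  c `^ (a + 1) / Gamma (a + 1) *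
  \int[mu]_(t in `[0, +oo[) (t `^ a * expR (- (c * t)) * f t).

(** Each factor t raises the exponent of the kernel by one, so the moments follow from the
    functional equation of Gamma. Integrability is included because these quadratics serve as
    dominating functions. *)
Lemma gamma_mean_quadratic a c p0 p1 p2 : 0 <= a -> 0 < c ->
  mu.-integrable D (EFin \o
    (fun t => t `^ a * expR (- (c * t)) * (p0 + p1 * t + p2 * t ^+ 2))) /\
  gamma_mean a c (fun t => p0 + p1 * t + p2 * t ^+ 2) =
  p0 + p1 * ((a + 1) / c) + p2 * ((a + 1) * (a + 2) / c ^+ 2).
Proof.
move=> a0 c0.
pose W b t := t `^ b * expR (- (c * t)).
have a1 : 0 <= a + 1 by rewrite addr_ge0.
have a2 : 0 <= a + 1 + 1 by rewrite addr_ge0.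
have E t : 0 <= t -> W a t * (p0 + p1 * t + p2 * t ^+ 2) =
    p0 * W a t + p1 * W (a + 1) t + p2 * W (a + 1 + 1) t.
  move=> t0; have -> : W (a + 1 + 1) t = W a t * t * t.
    by rewrite /W (gamma_kernelS (a + 1))// (gamma_kernelS a).
  have -> : W (a + 1) t = W a t * t by rewrite /W (gamma_kernelS a).
  by move: (W a t) => w; ring.
have iW b p : 0 <= b -> mu.-integrable D (EFin \o (fun t => p * W b t)).
  move=> b0; rewrite (_ : _ \o _ = (fun t => p%:E * (EFin \o W b) t)%E)//.
  by apply: integrableZl => //; exact: integrable_gamma_kernel.
have iW2 : mu.-integrable D (EFin \o (fun t => p0 * W a t + p1 * W (a + 1) t)).
  by apply: integrable_add; exact: iW.
have iWD : mu.-integrable D (EFin \o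
    (fun t => p0 * W a t + p1 * W (a + 1) t + p2 * W (a + 1 + 1) t)).
  by apply: integrable_add => //; exact: iW.
split.
  apply: eq_integrable iWD => // t; rewrite inE/= in_itv/= andbT => t0.
  by rewrite -/(W a t) E.
have G0 := Gamma_gt0 _ (ltr_wpDl a0 ltr01).
rewrite /gamma_mean (@eq_Rintegral _ _ _ mu D
    (fun t => p0 * W a t + p1 * W (a + 1) t + p2 * W (a + 1 + 1) t)); last first.
  by move=> t; rewrite inE/= in_itv/= andbT => t0; rewrite -/(W a t) E.
rewrite RintegralD//; last exact: iW.
rewrite RintegralD//; [|exact: iW|exact: iW].
rewrite !RintegralZl//; [|exact: integrable_gamma_kernel..].
rewrite !Rintegral_gamma_kernel//.
rewrite !(@GammaS _ (a + 1 + 1)) ?ltr_wpDl// !(@GammaS _ (a + 1)) ?ltr_wpDl//.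
rewrite !(@powRD _ c (_ + _) 1) ?(gt_eqF c0) ?implybT// !powRr1 ?(ltW c0)//.
have ca0 : c `^ (a + 1) != 0 by rewrite gt_eqF// powR_gt0.
move: (c `^ (a + 1)) (Gamma (a + 1)) ca0 (lt0r_neq0 G0) (lt0r_neq0 c0) => u v u0 v0 cn0.
by field; rewrite u0 v0 cn0.
Qed.

(** The density has mass 1, so the difference is the mean of f - L. The quadratic bound gives both
    the integrability of f against the kernel and the estimate. *)
Lemma gamma_mean_dist a c L p0 p1 p2 (f : R -> R) : 0 <= a -> 0 < c ->
  measurable_fun D f ->
  (forall t, 0 <= t -> `|f t - L| <= p0 + p1 * t + p2 * t ^+ 2) ->
  `|gamma_mean a c f - L| <=
    p0 + p1 * ((a + 1) / c) + p2 * ((a + 1) * (a + 2) / c ^+ 2).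
Proof.
move=> a0 c0 mf fL.
pose W t := t `^ a * expR (- (c * t)).
have W0 t : 0 <= W t by rewrite mulr_ge0 ?powR_ge0 ?expR_ge0.
have G0 := Gamma_gt0 _ (ltr_wpDl a0 ltr01).
have [iP <-] := gamma_mean_quadratic a c p0 p1 p2 a0 c0.
have [iL EL] := gamma_mean_quadratic a c L 0 0 a0 c0.
have iWL : mu.-integrable D (EFin \o (fun t => W t * L)).
  apply: eq_integrable iL => // t _ /=.
  by rewrite !mul0r !addr0.
have mean_L : c `^ (a + 1) / Gamma (a + 1) *
    \int[mu]_(t in `[0, +oo[) (W t * L) = L.
  rewrite -[RHS](_ : L + 0 * ((a + 1) / c) + 0 * ((a + 1) * (a + 2) / c ^+ 2) = L).
    by rewrite -EL; congr (_ * _); apply: eq_Rintegral => t _; rewrite !mul0r !addr0.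
  by rewrite !mul0r !addr0.
have iWfL : mu.-integrable D (EFin \o (fun t => W t * (f t - L))).
  apply: le_integrable iP => //.
    apply/measurable_EFinP; apply: measurable_funM.
      exact: measurable_gamma_kernel.
    exact: measurable_funB.
  move=> t /=; rewrite in_itv/= andbT => t0.
  by rewrite lee_fin !normrM ler_wpM2l// (le_trans (fL _ t0))// ler_norm.
have iWf : mu.-integrable D (EFin \o (fun t => W t * f t)).
  apply: eq_integrable (integrable_add _ _ iWfL iWL) => // t _ /=.
  by rewrite mulrBr subrK.
rewrite -{1}mean_L /gamma_mean -mulrBr -RintegralB// normrM.
have Z0 : 0 <= c `^ (a + 1) / Gamma (a + 1) by rewrite divr_ge0 ?powR_ge0// ltW.
rewrite ger0_norm// ler_wpM2l//.
rewrite (@eq_Rintegral _ _ _ mu D (fun t => W t * (f t - L))); last first.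
  by move=> t _; rewrite mulrBr.
apply: le_trans (le_normr_Rintegral _ _) _ => //.
apply: le_Rintegral => //.
  by apply: (integrable_abse iWfL).
move=> t; rewrite /= in_itv/= andbT => t0.
by rewrite normrM ger0_norm// ler_wpM2l// fL.
Qed.

End gamma_kernel.

(** * Series and the Dunkl exponential *)

Section real_series.
Context {R : realType}.
Implicit Types (u v : R ^nat) (c l : R).

Lemma cvg_series_mull c u l :
  series u @ \oo --> l -> series (fun k => c * u k) @ \oo --> c * l.
Proof.
move=> ul; rewrite (_ : series _ = (fun n => c * series u n)).
  exact: cvgMl_tmp.
by apply/funext => n; rewrite !seriesEnat/= mulr_sumr.
Qed.

Lemma cvg_series_add u v l m : series u @ \oo --> l -> series v @ \oo --> m ->
  series (fun k => u k + v k) @ \oo --> l + m.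
Proof.
move=> ul vm; rewrite (_ : series _ = (fun n => series u n + series v n)).
  exact: cvgD.
by apply/funext => n; rewrite !seriesEnat/= big_split.
Qed.

Lemma cvg_series_shift u v l :
  v 0%N = 0 -> (forall k, v k.+1 = u k) ->
  series u @ \oo --> l -> series v @ \oo --> l.
Proof.
move=> v0 vS; rewrite -[X in _ -> X]cvg_shiftS; apply: cvg_trans.
apply: near_eq_cvg; apply: nearW => n /=.
rewrite !seriesEnat/= big_nat_recl// v0 add0r.
by apply: eq_bigr => k _.
Qed.


Lemma cvg_exp_coeff_index1 (y : R) :
  series (fun k => k%:R * exp_coeff y k) @ \oo --> y * expR y.
Proof.
apply: (@cvg_series_shift (fun k => y * exp_coeff y k)).
- by rewrite mul0r.
- move=> k; rewrite /exp_coeff/= factS natrM (exprS y) -(natr1 k).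
  have k0 : k%:R + 1 != 0 :> R by rewrite natr1 pnatr_eq0.
  have f0 : k`!%:R != 0 :> R by rewrite pnatr_eq0 -lt0n fact_gt0.
  by field; rewrite f0 k0.
by apply: cvg_series_mull; exact: is_cvg_series_exp_coeff.
Qed.

(** The coefficients u_k satisfy (k+1)^2 u_{k+1} = y (k+1) u_k, which reduces the second moment to
    the first and the total mass. *)
Lemma cvg_exp_coeff_index2 (y : R) :
  series (fun k => k%:R ^+ 2 * exp_coeff y k) @ \oo --> y * (y + 1) * expR y.
Proof.
rewrite -mulrA mulrDl mul1r.
apply: (@cvg_series_shift (fun k => y * (k%:R * exp_coeff y k + exp_coeff y k))).
- by rewrite expr0n mul0r.
- move=> k; rewrite /exp_coeff/= factS natrM (exprS y) -(natr1 k).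
  have k0 : k%:R + 1 != 0 :> R by rewrite natr1 pnatr_eq0.
  have f0 : k`!%:R != 0 :> R by rewrite pnatr_eq0 -lt0n fact_gt0.
  by field; rewrite f0 k0.
apply: cvg_series_mull; apply: cvg_series_add; first exact: cvg_exp_coeff_index1.
exact: is_cvg_series_exp_coeff.
Qed.

(** The coefficient of t^k in the product of the power series sum u_j t^(2j) and sum v_m t^m. *)
Definition conv2 u v k := \sum_(0 <= j < (k./2).+1) u j * v (k - 2 * j)%N.

Lemma conv2_ge0 u v k : (forall j, 0 <= u j) -> (forall j, 0 <= v j) ->
  0 <= conv2 u v k.
Proof. by move=> u0 v0; apply: sumr_ge0 => j _; rewrite mulr_ge0. Qed.

(** The partial sum runs over the lattice triangle 2j + m < n, written as a filtered sum over the n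
    by n square to ease comparison with products of partial sums. *)
Lemma series_conv2 u v n : series (conv2 u v) n =
  \sum_(0 <= j < n) \sum_(0 <= m < n | (2 * j + m < n)%N) u j * v m.
Proof.
have -> : series (conv2 u v) n =
    \sum_(0 <= k < n) \sum_(0 <= j < n | (2 * j <= k)%N) u j * v (k - 2 * j)%N.
  rewrite seriesEnat/=; apply: eq_big_nat => k /andP[_ kn].
  rewrite /conv2 [LHS](big_nat_widen _ _ n)/=; last first.
    by move: kn; lia.
  by apply: eq_bigl => j; apply/idP/idP; lia.
rewrite (exchange_big_dep_nat predT)//=; apply: eq_big_nat => j _.
rewrite -(big_nat_widenl (2 * j) 0 n xpredT)//= -{1}(add0n (2 * j)%N) big_addn.
rewrite (big_nat_widen _ _ n) ?leq_subr//=; apply: eq_big => m.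
  by rewrite ltn_subRL.
by rewrite addnK.
Qed.

(** With nonnegative terms, inclusions between triangles and squares of indices sandwich the partial
    sums between products of partial sums. *)
Lemma cvg_series_conv2 u v l m : (forall j, 0 <= u j) -> (forall j, 0 <= v j) ->
  series u @ \oo --> l -> series v @ \oo --> m ->
  series (conv2 u v) @ \oo --> l * m.
Proof.
move=> u0 v0 ul vm.
have uvE n : series u n * series v n =
    \sum_(0 <= j < n) \sum_(0 <= k < n) u j * v k.
  by rewrite !seriesEnat/= big_distrlr.
have upper n : series (conv2 u v) n <= series u n * series v n.
  rewrite series_conv2 uvE; apply: ler_sum => j _; rewrite big_mkcond/=.
  by apply: ler_sum => k _; case: ifP => // _; rewrite mulr_ge0.
(* The factor 3 suffices: j, k < n imply 2j + k < 3n. *)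
have lower n : series u n * series v n <= series (conv2 u v) (3 * n).
  have n3 : (n <= 3 * n)%N by rewrite leq_pmull.
  rewrite series_conv2 uvE (big_nat_widen _ _ (3 * n))//= big_mkcond/=.
  apply: ler_sum => j _; case: ifP => jn; last first.
    by apply: sumr_ge0 => k _; rewrite mulr_ge0.
  rewrite (big_nat_widen _ _ (3 * n))//= big_mkcond [leRHS]big_mkcond/=.
  apply: ler_sum => k _; case: ifP => kn; last by case: ifP => // _; rewrite mulr_ge0.
  by rewrite ifT//; move: jn kn; lia.
have nd (w : R ^nat) : (forall j, 0 <= w j) -> nondecreasing_seq (series w).
  by move=> w0; exact: nondecreasing_series.
have sle (w : R ^nat) a : (forall j, 0 <= w j) -> series w @ \oo --> a -> forall n, series w n <= a.
  move=> w0 wa n; rewrite -(cvg_lim (@norm_hausdorff _ _) wa).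
  by apply: nondecreasing_cvgn_le; [exact: nd|apply/cvg_ex; exists a].
have s0 (w : R ^nat) n : (forall j, 0 <= w j) -> 0 <= series w n.
  by move=> w0; rewrite seriesEnat/=; exact: sumr_ge0.
have c0 k : 0 <= conv2 u v k by exact: conv2_ge0.
have uvlm : (fun n => series u n * series v n) @ \oo --> l * m by exact: cvgM.
have /cvg_ex[L cL] : cvgn (series (conv2 u v)).
  apply: nondecreasing_is_cvgn; first exact: nd.
  exists (l * m) => _ [n _ <-]; apply: le_trans (upper n) _.
  by rewrite ler_pM ?s0// ?(sle u)// ?(sle v).
suff <- : L = l * m by [].
apply/le_anti/andP; split.
- rewrite -(cvg_lim (@norm_hausdorff _ _) cL) -(cvg_lim (@norm_hausdorff _ _) uvlm).
  apply: ler_lim; [by apply/cvg_ex; exists L|by apply/cvg_ex; exists (l * m)|].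
  by apply: nearW => n; exact: upper.
- rewrite -(cvg_lim (@norm_hausdorff _ _) uvlm).
  apply: limr_le; first by apply/cvg_ex; exists (l * m).
  by apply: nearW => n; apply: le_trans (lower n) _; exact: sle.
Qed.

End real_series.

(** * The factors gamma_mu(k), the indices B_k and their moments *)

Section dunkl.
Context {R : realType} (mu : R) (hmu : - (1 / 2) < mu).
Implicit Types (k : nat) (y : R).

Definition dunkl_index k : R := k%:R + 2 * mu * theta k.
Local Notation B := dunkl_index.
Local Notation gam := (dunkl_gamma mu).

Lemma dunkl_index0 : B 0 = 0.
Proof. by rewrite /B /theta/= mulr0 addr0. Qed.

Lemma dunkl_indexS k : B k.+1 = B k + 1 + 2 * mu * (-1) ^+ k.
Proof.
rewrite /B /theta/= -natr1 -signr_odd.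
by case: (odd k); rewrite /= ?expr0 ?expr1; ring.
Qed.

Lemma dunkl_index_even j k : (2 * j <= k)%N ->
  B k = 2 * j%:R + B (k - 2 * j).
Proof.
move=> jk; rewrite /B /theta oddB// mul2n odd_double addbF natrB -?mul2n//.
by rewrite natrM; ring.
Qed.

(** Since 2 mu > -1, the parity term lowers the index by less than 1. Strictness matters for B_1,
    where the bound is 0. *)
Lemma dunkl_index_ge k : k.+1%:R - 1 < B k.+1.
Proof.
rewrite /B ltrD2l /theta; case: ifP => _; move: hmu; lra.
Qed.

Lemma dunkl_index_ge0 k : 0 <= B k.
Proof.
case: k => [|k]; first by rewrite dunkl_index0.
by rewrite ltW// (le_lt_trans _ (dunkl_index_ge k))// -natr1 addrK.
Qed.

Lemma dunkl_gamma0 : gam 0 = 1.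
Proof.
rewrite /dunkl_gamma/= expr0 fact0 !mul1r add0r divff// gt_eqF//.
by apply: Gamma_gt0; move: hmu; lra.
Qed.

(** From odd k the Gamma values agree and the factorial supplies the ratio; from even k the
    factorials agree and the functional equation of Gamma supplies k + 1 + 2 mu. *)
Lemma dunkl_gammaS k : gam k.+1 = B k.+1 * gam k.
Proof.
have half_gt0 : 0 < k./2%:R + mu + 1 / 2.
  by rewrite -addrA ltr_wpDl//; move: hmu; lra.
have kE : k%:R = (odd k)%:R + 2 * k./2%:R :> R.
  by rewrite -{1}(odd_double_half k) -mul2n natrD natrM.
have G0 : Gamma (mu + 1 / 2) != 0.
  by rewrite gt_eqF//; apply: Gamma_gt0; move: hmu; lra.
rewrite /dunkl_gamma /B /theta /= uphalf_half exprS -(natr1 k) kE.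
move: (2 ^+ k) => p; case: (odd k) => /=.
- rewrite add1n factS natrM -(natr1 k./2).
  rewrite (_ : k./2%:R + 1 + mu + 1 / 2 = k./2%:R + mu + 3 / 2); last by field.
  by field.
- rewrite add0n (_ : k./2%:R + mu + 3 / 2 = k./2%:R + mu + 1 / 2 + 1); last by field.
  by rewrite GammaS//; field.
Qed.

Lemma dunkl_gamma_gt0 k : 0 < gam k.
Proof.
elim: k => [|k IHk]; first by rewrite dunkl_gamma0.
rewrite dunkl_gammaS mulr_gt0// (le_lt_trans _ (dunkl_index_ge k))//.
Qed.

(** Only B_{k+2} > k + 1 is available for negative mu, so the factorial lags one index behind. This
    compares the Dunkl series with the exponential series. *)
Lemma dunkl_gamma_ge_fact k : k`!%:R * gam 1 <= gam k.+1.
Proof.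
elim: k => [|k IHk]; first by rewrite fact0 mul1r.
rewrite (dunkl_gammaS k.+1) factS natrM -mulrA ler_pM//.
  by rewrite mulr_ge0// ltW// dunkl_gamma_gt0.
by rewrite ltW// (le_lt_trans _ (dunkl_index_ge _))// -(natr1 k.+1) addrK.
Qed.

Definition dunkl_coeff y k := y ^+ k / gam k.

Lemma cvg_dunkl_exp y : series (dunkl_coeff y) @ \oo --> dunkl_exp mu y.
Proof.
suff : cvgn (series (dunkl_coeff y)) by [].
apply: normed_cvg.
have cexp : cvgn (series ((`|y| / gam 1) *: exp_coeff `|y|)).
  by apply: is_cvg_seriesZ; exact: is_cvg_series_exp_coeff.
have /cvg_ex[l sl] : cvgn (series (fun k => `|dunkl_coeff y k.+1|)).
  apply: (@series_le_cvg _ _ _ _ _ _ cexp) => k //.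
    by rewrite mulr_ge0 ?exp_coeff_ge0// divr_ge0// ltW// dunkl_gamma_gt0.
  rewrite fctE /GRing.scale/=.
  rewrite /dunkl_coeff /exp_coeff/= normrM normfV normrX.
  rewrite (gtr0_norm (dunkl_gamma_gt0 _)) exprS.
  rewrite [leRHS](_ : _ = `|y| * `|y| ^+ k / (k`!%:R * gam 1)); last first.
    by move: (gam 1) => G; rewrite invfM; ring.
  rewrite ler_wpM2l ?mulr_ge0 ?exprn_ge0// lef_pV2 ?posrE ?dunkl_gamma_gt0//.
    exact: dunkl_gamma_ge_fact.
  by rewrite mulr_gt0 ?dunkl_gamma_gt0// ltr0n fact_gt0.
(* The comparison covers the terms from index 1 on; the term of index 0 equals 1. *)
apply/cvg_ex; exists (l + 1).
rewrite -cvg_shiftS.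
rewrite (_ : mk_sequence _ =
    (fun n => series (fun k => `|dunkl_coeff y k.+1|) n + 1)); last first.
  apply/funext => n /=; rewrite seriesEnat/= big_nat_recl//.
  by rewrite [in LHS]/dunkl_coeff expr0 dunkl_gamma0 divr1 normr1 addrC.
by apply: cvgD => //; exact: cvg_cst.
Qed.

Lemma dunkl_exp_gt0 y : 0 <= y -> 0 < dunkl_exp mu y.
Proof.
move=> y0; apply: (@lt_le_trans _ _ 1) => //.
have := cvg_dunkl_exp y.
suff: series (dunkl_coeff y) 1 <= limn (series (dunkl_coeff y)).
  by rewrite seriesEnat/= big_nat1 /dunkl_coeff expr0 dunkl_gamma0 divr1.
apply: nondecreasing_cvgn_le; last by apply/cvg_ex; eexists; exact: cvg_dunkl_exp.
apply: nondecreasing_series => k _ _.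
by rewrite divr_ge0 ?exprn_ge0// ltW// dunkl_gamma_gt0.
Qed.

Lemma dunkl_index_coeffS y k :
  B k.+1 * dunkl_coeff y k.+1 = y * dunkl_coeff y k.
Proof.
rewrite /dunkl_coeff dunkl_gammaS exprS.
have B0 : B k.+1 != 0.
  by rewrite gt_eqF// (le_lt_trans _ (dunkl_index_ge k))// -natr1 addrK.
move: (gam k) (B k.+1) (lt0r_neq0 (dunkl_gamma_gt0 k)) B0 => c b c0 b0.
by field; rewrite c0 b0.
Qed.

Lemma cvg_dunkl_index1 y :
  series (fun k => B k * dunkl_coeff y k) @ \oo --> y * dunkl_exp mu y.
Proof.
apply: (@cvg_series_shift _ (fun k => y * dunkl_coeff y k)).
- by rewrite dunkl_index0 mul0r.
- by move=> k; exact: dunkl_index_coeffS.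
by apply: cvg_series_mull; exact: cvg_dunkl_exp.
Qed.

(** One factor B_{k+1} lowers the coefficient, and the other is B_k + 1 + 2 mu (-1)^k. The sign
    turns y^k into (-y)^k, whence the value of the Dunkl exponential at -y. *)
Lemma cvg_dunkl_index2 y :
  series (fun k => B k ^+ 2 * dunkl_coeff y k) @ \oo -->
  y * (y * dunkl_exp mu y + dunkl_exp mu y + 2 * mu * dunkl_exp mu (- y)).
Proof.
apply: (@cvg_series_shift _ (fun k => y * (B k * dunkl_coeff y k +
  dunkl_coeff y k + 2 * mu * dunkl_coeff (- y) k))).
- by rewrite dunkl_index0 expr0n mul0r.
- move=> k; rewrite expr2 -mulrA dunkl_index_coeffS dunkl_indexS.
  by rewrite /dunkl_coeff (exprNn y); ring.
apply: cvg_series_mull; apply: cvg_series_add.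
  by apply: cvg_series_add; [exact: cvg_dunkl_index1|exact: cvg_dunkl_exp].
by apply: cvg_series_mull; exact: cvg_dunkl_exp.
Qed.

End dunkl.

(** * The modulus of continuity *)

Section modulus.
Context {R : realType} (f : R -> R).
Implicit Types d s t C : R.

Lemma norm_chain_le d C (m : nat) s t :
    (forall u v, 0 <= u -> 0 <= v -> `|u - v| <= d -> `|f u - f v| <= C) ->
    0 <= s -> 0 <= t -> `|s - t| <= m%:R * d ->
  `|f s - f t| <= m%:R * C.
Proof.
move=> dC s0; elim: m t => [|m IHm] t t0.
  by rewrite !mul0r !normr_le0 !subr_eq0 => /eqP ->.
move=> st.
have m1 : m.+1%:R != 0 :> R by rewrite pnatr_eq0.
(* The last of m + 1 equal steps from s to t starts at r; as a convex combination it stays in the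
   half-line. *)
pose r := s / m.+1%:R + t * (m%:R / m.+1%:R).
have r0 : 0 <= r by rewrite addr_ge0 ?mulr_ge0 ?divr_ge0 ?invr_ge0.
have sr : `|s - r| <= m%:R * d.
  have -> : s - r = (s - t) * (m%:R / m.+1%:R).
    by rewrite /r; move: m1; rewrite -natr1 => m1; field.
  rewrite normrM [X in _ * X]ger0_norm ?divr_ge0// mulrA ler_pdivrMr// mulrC.
  by rewrite -mulrA ler_wpM2l// mulrC.
have rt : `|r - t| <= d.
  have -> : r - t = (s - t) / m.+1%:R.
    by rewrite /r; move: m1; rewrite -natr1 => m1; field.
  by rewrite normrM [X in _ * X]ger0_norm// ler_pdivrMr// mulrC.
rewrite -natr1 mulrDl mul1r (le_trans (ler_distD (f r) _ _))// lerD//.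
  exact: IHm.
exact: dC.
Qed.

Lemma norm_chain_le_truncn d C s t : 0 < d -> 0 <= C ->
    (forall u v, 0 <= u -> 0 <= v -> `|u - v| <= d -> `|f u - f v| <= C) ->
    0 <= s -> 0 <= t ->
  `|f s - f t| <= (1 + `|s - t| / d) * C.
Proof.
move=> d0 C0 dC s0 t0; pose m := (Num.truncn (`|s - t| / d)).+1.
have st0 : 0 <= `|s - t| / d by rewrite divr_ge0// ltW.
apply: (@le_trans _ _ (m%:R * C)).
  apply: norm_chain_le dC s0 t0 _.
  by rewrite -ler_pdivrMr// ltW// truncnS_gt.
by rewrite ler_wpM2r// /m -natr1 addrC lerD2l truncn_le.
Qed.

Context (hf : unif_continuous (f : subspace (`[0, +oo[ : set R) -> R)).

Let dist_lt (eps : R) : 0 < eps -> exists2 d, 0 < d &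
  forall u v, 0 <= u -> 0 <= v -> `|u - v| < d -> `|f u - f v| < eps.
Proof.
move: hf => /unif_continuousP h /h[d d0 fd]; exists d => // u v u0 v0 uv.
apply: (fd (u, v)); rewrite ball_subspace_ball /subspace_ball /=.
rewrite mem_set/=; last by rewrite in_itv/= u0.
by split => //=; rewrite in_itv/= v0.
Qed.

(** Uniform continuity at tolerance 1 bounds small increments, and chaining bounds those at distance
    d. Halving the radius [e] turns the strict condition on distances into a non-strict one. *)
Lemma unif_continuous_has_sup d : 0 <= d ->
  has_sup [set r : R | exists s t : R,
    [/\ 0 <= s, 0 <= t, `|s - t| <= d & r = `|f s - f t|]].
Proof.
move=> d0; split.
  by exists 0, 0, 0; split; rewrite ?subrr ?normr0.
have [e e0 fe] := dist_lt _ ltr01.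
have fe1 u v : 0 <= u -> 0 <= v -> `|u - v| <= e / 2 -> `|f u - f v| <= 1.
  move=> u0 v0 uv; apply/ltW/fe => //.
  by rewrite (le_lt_trans uv)// ltr_pdivrMr// ltr_pMr// ltr1n.
exists ((1 + d / (e / 2)) * 1) => _ [s [t [s0 t0 st ->]]].
have e20 : 0 < e / 2 by rewrite divr_gt0.
rewrite (le_trans (norm_chain_le_truncn _ _ _ _ e20 ler01 fe1 s0 t0))//.
by rewrite !mulr1 lerD2l ler_pM2r// invr_gt0.
Qed.

Lemma omega_ge0 d : 0 <= d -> 0 <= omega f d.
Proof.
move=> d0; apply: ub_le_sup; first exact: (unif_continuous_has_sup _ d0).2.
by exists 0, 0; split; rewrite ?subrr ?normr0.
Qed.

Lemma le_omega d s t : 0 < d -> 0 <= s -> 0 <= t ->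
  `|f s - f t| <= (1 + `|s - t| / d) * omega f d.
Proof.
move=> d0 s0 t0; apply: norm_chain_le_truncn => //.
  by apply: omega_ge0; exact: ltW.
move=> u v u0 v0 uv.
apply: ub_le_sup; first exact: (unif_continuous_has_sup _ (ltW d0)).2.
by exists u, v.
Qed.

Lemma unif_continuous_measurable : measurable_fun (`[0, +oo[%classic : set R) f.
Proof.
apply: subspace_continuous_measurable_fun => //.
apply/subspace_continuousP => u /=; rewrite in_itv/= andbT => u0.
apply/cvgrPdist_lt => eps /dist_lt[d d0 fd].
exists d => //= v uv; rewrite in_itv/= andbT => v0.
exact: fd.
Qed.

End modulus.

(** * The operator *)

(** The generating function e^(alpha t^2) e_mu(xi t), coefficient by coefficient, with powers of x
    absorbed into the two factors. *)
Lemma dunkl_hermite_conv2 (R : realType) (mu xi alpha x : R) k :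
  - (1 / 2) < mu ->
  dunkl_hermite mu k xi alpha / dunkl_gamma mu k * x ^+ k =
  conv2 (exp_coeff (alpha * x ^+ 2)) (dunkl_coeff mu (xi * x)) k.
Proof.
move=> hmu; have gam0 j := lt0r_neq0 (dunkl_gamma_gt0 mu hmu j).
rewrite /dunkl_hermite /conv2.
rewrite [X in X * _](_ : _ = \sum_(0 <= j < (k./2).+1)
    (alpha ^+ j * xi ^+ (k - 2 * j) / (j`!%:R * dunkl_gamma mu (k - 2 * j)))); last first.
  by rewrite mulrAC divff// mul1r.
rewrite mulr_suml; apply: eq_big_nat => j /andP[_ jk].
have {jk} jk : (2 * j <= k)%N by move: jk; lia.
have -> : x ^+ k = (x ^+ 2) ^+ j * x ^+ (k - 2 * j) by rewrite -exprM -exprD subnKC.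
rewrite /exp_coeff /dunkl_coeff/= !exprMn.
have j0 : j`!%:R != 0 :> R by rewrite pnatr_eq0 -lt0n fact_gt0.
move: (dunkl_gamma mu _) (gam0 (k - 2 * j)%N) => c c0.
by field; rewrite c0 j0.
Qed.

(** Inside the convolution B_k = 2j + B_m with m = k - 2j, so B_k^2 = 4 j^2 + 4 j B_m + B_m^2. Each
    monomial is again a convolution of reweighted sequences and sums to a product. *)
Lemma cvg_conv2_moments (R : realType) (mu a y p0 p1 p2 : R) :
  - (1 / 2) < mu -> 0 <= a -> 0 <= y ->
  let E := dunkl_exp mu y in
  let w := conv2 (exp_coeff a) (dunkl_coeff mu y) in
  series (fun k => w k *
    (p0 + p1 * dunkl_index mu k + p2 * dunkl_index mu k ^+ 2)) @ \oo -->
  p0 * (expR a * E) +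
  p1 * (2 * (a * expR a * E) + expR a * (y * E)) +
  p2 * (4 * (a * (a + 1) * expR a * E) + 4 * (a * expR a * (y * E)) +
        expR a * (y * (y * E + E + 2 * mu * dunkl_exp mu (- y)))).
Proof.
move=> hmu a0 y0 E w.
pose B := dunkl_index mu; pose u := exp_coeff a; pose v := dunkl_coeff mu y.
have u0 j : 0 <= u j by exact: exp_coeff_ge0.
have v0 j : 0 <= v j.
  by rewrite divr_ge0 ?exprn_ge0// ltW// dunkl_gamma_gt0.
have B0 j : 0 <= B j by exact: dunkl_index_ge0.
pose u1 (j : nat) : R := j%:R * u j; pose u2 (j : nat) : R := j%:R ^+ 2 * u j.
pose v1 (j : nat) : R := B j * v j; pose v2 (j : nat) : R := B j ^+ 2 * v j.
have u10 j : 0 <= u1 j by rewrite mulr_ge0.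
have u20 j : 0 <= u2 j by rewrite mulr_ge0 ?exprn_ge0.
have v10 j : 0 <= v1 j by rewrite mulr_ge0.
have v20 j : 0 <= v2 j by rewrite mulr_ge0 ?exprn_ge0.
have cu : series u @ \oo --> expR a by exact: is_cvg_series_exp_coeff.
have cu1 : series u1 @ \oo --> a * expR a by exact: cvg_exp_coeff_index1.
have cu2 : series u2 @ \oo --> a * (a + 1) * expR a by exact: cvg_exp_coeff_index2.
have cv : series v @ \oo --> E by exact: cvg_dunkl_exp.
have cv1 : series v1 @ \oo --> y * E by exact: cvg_dunkl_index1.
have cv2 := cvg_dunkl_index2 mu hmu y; rewrite -/v2 -/E in cv2.
have wE k : w k * (p0 + p1 * B k + p2 * B k ^+ 2) =
    p0 * conv2 u v k + p1 * (2 * conv2 u1 v k + conv2 u v1 k) +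
    p2 * (4 * conv2 u2 v k + 4 * conv2 u1 v1 k + conv2 u v2 k).
  rewrite /w /conv2 mulr_suml !mulr_sumr -!big_split/= !mulr_sumr -!big_split/=.
  apply: eq_big_nat => j /andP[_ jk].
  have {jk} jk : (2 * j <= k)%N by move: jk; lia.
  rewrite /v1 /v2 /u1 /u2 -/u -/v /B (dunkl_index_even mu _ _ jk).
  move: (dunkl_index mu _) (u j) (v _) => b ? ?; ring.
rewrite (_ : (fun k => _) = (fun k =>
    p0 * conv2 u v k + p1 * (2 * conv2 u1 v k + conv2 u v1 k) +
    p2 * (4 * conv2 u2 v k + 4 * conv2 u1 v1 k + conv2 u v2 k))); last first.
  by apply/funext => k; exact: wE.
apply: cvg_series_add; [apply: cvg_series_add|]; apply: cvg_series_mull.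
- exact: cvg_series_conv2.
- apply: cvg_series_add; last exact: cvg_series_conv2.
  by apply: cvg_series_mull; exact: cvg_series_conv2.
- apply: cvg_series_add; last exact: cvg_series_conv2.
  by apply: cvg_series_add; apply: cvg_series_mull; exact: cvg_series_conv2.
Qed.

(** The weights have total S, so the difference is the mean of K_k - L. Domination by w_k b_k makes
    that series absolutely convergent, which also yields convergence of the series behind [limn]. *)
Lemma weighted_mean_dist (R : realType) (w K b : R ^nat) (S T L : R) :
    (forall k, 0 <= w k) -> 0 < S -> series w @ \oo --> S ->
    (forall k, `|K k - L| <= b k) -> series (fun k => w k * b k) @ \oo --> T ->
  `|S^-1 * limn (series (fun k => w k * K k)) - L| <= T / S.
Proof.
move=> w0 S0 wS Kb wbT.
pose d k := w k * (K k - L).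
have dwb k : `|d k| <= w k * b k by rewrite normrM ger0_norm// ler_wpM2l.
have cwb : cvgn (series (fun k => w k * b k)) by apply/cvg_ex; exists T.
have nd : cvgn [normed series d].
  apply: (@series_le_cvg _ _ _ _ _ _ cwb) => k; last exact: dwb.
    exact: normr_ge0.
  by rewrite mulr_ge0// (le_trans _ (Kb k)).
have dT : `|limn (series d)| <= T.
  apply: le_trans (lim_series_norm nd) _.
  rewrite -(cvg_lim (@norm_hausdorff _ _) wbT); apply: ler_lim => //.
  by apply: nearW => n; rewrite /series/=; apply: ler_sum => k _; exact: dwb.
have cK : series (fun k => w k * K k) @ \oo --> limn (series d) + L * S.
  rewrite (_ : (fun k => _) = (fun k => d k + L * w k)); last first.
    by apply/funext => k; rewrite /d; ring.
  by apply: cvg_series_add; [exact: normed_cvg|exact: cvg_series_mull].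
rewrite (cvg_lim (@norm_hausdorff _ _) cK) mulrDr mulrCA mulVf ?gt_eqF// mulr1 addrK.
by rewrite normrM normfV (gtr0_norm S0) mulrC ler_wpM2r// invr_ge0 ltW.
Qed.

Lemma szasz_gamma_dist (R : realType) (alpha mu lambda : R) (g : R -> R)
    (n : nat) (x c : R) :
    0 <= alpha -> - (1 / 2) < mu -> 0 <= lambda -> (0 < n)%N -> 0 <= x ->
    unif_continuous (g : subspace (`[0, +oo[ : set R) -> R) -> 0 < c ->
    x ^+ 2 / n%:R *
      (4 * x ^+ 2 * alpha ^+ 2 + 4 * lambda * alpha + 10 * alpha)
    + 2 * x *
      (mu * (dunkl_exp mu (- (n%:R * x)) / dunkl_exp mu (n%:R * x)) + 1)
    + (lambda + 1) * (lambda + 2) / n%:R <= c ^+ 2 ->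
  `|szasz_gamma alpha mu lambda n g x - g x| <=
    (1 + c) * omega g (1 / Num.sqrt n%:R).
Proof.
move=> halpha hmu hlambda hn hx hg c0 Mc.
have N0 : 0 < n%:R :> R by rewrite ltr0n.
have nx0 : 0 <= n%:R * x by rewrite mulr_ge0.
have s0 : 0 < Num.sqrt n%:R :> R by rewrite sqrtr_gt0.
have sqN : Num.sqrt n%:R ^+ 2 = n%:R :> R by rewrite sqr_sqrtr.
pose om := omega g (1 / Num.sqrt n%:R).
have om0 : 0 <= om by apply: omega_ge0 => //; rewrite divr_ge0.
(* The coefficients in t of om (1 + (c^2 + n (t - x)^2) / (2c)). *)
pose p0 := om * (1 + c / 2 + n%:R * x ^+ 2 / (2 * c)).
pose p1 := - (om * n%:R * x / c).
pose p2 := om * n%:R / (2 * c).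
have gx t : 0 <= t -> `|g t - g x| <= p0 + p1 * t + p2 * t ^+ 2.
  move=> t0; apply: le_trans (le_omega g hg _ _ _ (divr_gt0 ltr01 s0) t0 hx) _.
  (* AM-GM: 2 c z <= c^2 + z^2 for z = sqrt(n) |t - x|. *)
  have -> : p0 + p1 * t + p2 * t ^+ 2 =
      (1 + (c ^+ 2 + (`|t - x| * Num.sqrt n%:R) ^+ 2) / (2 * c)) * om.
    rewrite exprMn sqN real_normK ?num_real// /p0 /p1 /p2.
    by field; rewrite gt_eqF.
  rewrite ler_wpM2r// lerD2l invf_div divr1 ler_pdivlMr ?mulr_gt0//.
  rewrite -subr_ge0.
  set z := _ * Num.sqrt _.
  rewrite (_ : _ - _ = (c - z) ^+ 2) ?sqr_ge0//; ring.
pose A k := dunkl_index mu k + lambda.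
have A0 k : 0 <= A k by rewrite addr_ge0// dunkl_index_ge0.
pose a := alpha * x ^+ 2.
have a0 : 0 <= a by rewrite mulr_ge0// exprn_ge0.
pose y := n%:R * x.
pose w := conv2 (exp_coeff a) (dunkl_coeff mu y).
have w0 k : 0 <= w k.
  apply: conv2_ge0 => j; first exact: exp_coeff_ge0.
  by rewrite divr_ge0 ?exprn_ge0// ltW// dunkl_gamma_gt0.
have E0 : 0 < dunkl_exp mu y by exact: dunkl_exp_gt0.
(* The Gamma moments with a = B_k + lambda, regrouped by powers of B_k. *)
pose r0 := p0 + p1 * (lambda + 1) / n%:R + p2 * (lambda + 1) * (lambda + 2) / n%:R ^+ 2.
pose r1 := p1 / n%:R + p2 * (2 * lambda + 3) / n%:R ^+ 2.
pose r2 := p2 / n%:R ^+ 2.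
have Kg k : `|gamma_mean (A k) n%:R g - g x| <=
    r0 + r1 * dunkl_index mu k + r2 * dunkl_index mu k ^+ 2.
  apply: le_trans (gamma_mean_dist _ _ _ _ _ _ _ (A0 k) N0 _ gx) _.
    exact: unif_continuous_measurable.
  rewrite le_eqVlt; apply/orP; left; apply/eqP.
  by rewrite /r0 /r1 /r2 /A; field; rewrite gt_eqF.
have cw : series w @ \oo --> expR a * dunkl_exp mu y.
  have /= := cvg_conv2_moments R mu a y 1 0 0 hmu a0 nx0.
  rewrite !mul0r !addr0 mul1r.
  rewrite (_ : (fun k => _ * _) = w)//.
  by apply/funext => k; rewrite !mul0r !addr0 mulr1.
have -> : szasz_gamma alpha mu lambda n g x =
    (expR a * dunkl_exp mu y)^-1 *
    limn (series (fun k => w k * gamma_mean (A k) n%:R g)).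
  rewrite /szasz_gamma -/a -/y; congr (_ * _).
  apply: (congr1 (fun u : R ^nat => limn (series u))).
  by apply/funext => k; rewrite dunkl_hermite_conv2// -/a -/y -/w -mulrA.
have S0 : 0 < expR a * dunkl_exp mu y by rewrite mulr_gt0 ?expR_gt0.
apply: le_trans (weighted_mean_dist _ _ _ _ _ _ _ w0 S0 cw Kg
  (cvg_conv2_moments _ _ _ _ r0 r1 r2 hmu a0 nx0)) _.
rewrite [X in _ <= X]mulrC -/om.
set M := (X in X <= c ^+ 2) in Mc.
(* The averaged quadratic collapses to this closed form, and M <= c^2 bounds the fraction by c. *)
rewrite (_ : _ / _ = om * (1 + (c ^+ 2 + M) / (2 * c))).
  rewrite ler_wpM2l// lerD2l ler_pdivrMr ?mulr_gt0// mulrCA -expr2 mulr_natl mulr2n.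
  by rewrite lerD2l.
rewrite /r0 /r1 /r2 /p0 /p1 /p2 /M.
move: (lt0r_neq0 E0) (lt0r_neq0 (expR_gt0 a)) (lt0r_neq0 N0) (lt0r_neq0 c0).
rewrite -/y; move: (dunkl_exp mu y) (dunkl_exp mu (- y)) (expR a) => E E' e.
by rewrite /y /a => E_neq0 e0 N_neq0 c_neq0; field; rewrite c_neq0 N_neq0 e0 E_neq0.
Qed.

Theorem theorem3 (R : realType) (alpha mu lambda : R)
    (halpha : 0 <= alpha) (hmu : - (1 / 2) < mu) (hlambda : 0 <= lambda)
    (g : R -> R)
    (hg : unif_continuous (g : subspace (`[0, +oo[ : set R) -> R))
    (n : nat) (hn : (0 < n)%N) (x : R) (hx : 0 <= x) :
  `| szasz_gamma alpha mu lambda n g x - g x | <=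
  (1 + Num.sqrt
         (x ^+ 2 / n%:R *
            (4 * x ^+ 2 * alpha ^+ 2 + 4 * lambda * alpha + 10 * alpha)
          + 2 * x *
            (mu * (dunkl_exp mu (- (n%:R * x)) / dunkl_exp mu (n%:R * x)) + 1)
          + (lambda + 1) * (lambda + 2) / n%:R))
  * omega g (1 / Num.sqrt n%:R).
Proof.
set M := (X in Num.sqrt X); set om := omega _ _.
have om0 : 0 <= om by apply: omega_ge0 => //; rewrite divr_ge0// sqrtr_ge0.
have sqM0 : 0 <= Num.sqrt M by exact: sqrtr_ge0.
apply/ler_addgt0Pr => e e0.
have om1 : 0 < om + 1 by rewrite ltr_wpDl.
have e1 : 0 < e / (om + 1) by rewrite divr_gt0.
(* The excess over the square root costs at most e after multiplication by om. Dividing by om + 1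
   covers om = 0, and c > 0 holds even when the root vanishes. *)
pose c := Num.sqrt M + e / (om + 1).
have c0 : 0 < c by rewrite ltr_wpDl.
have Mc : M <= c ^+ 2.
  rewrite (@le_trans _ _ (Num.sqrt M ^+ 2))//.
    (* [Num.sqrt] is 0 on negative reals, so the inequality holds for either sign of M. *)
    by have [M0|M0] := leP 0 M; [rewrite sqr_sqrtr|rewrite (le_trans (ltW M0))// sqr_ge0].
  by rewrite ler_sqr ?nnegrE ?(ltW c0)// /c lerDl ltW.
rewrite (le_trans (szasz_gamma_dist R _ _ _ _ _ _ c halpha hmu hlambda hn hx hg c0 Mc))//.
rewrite -/om /c addrA mulrDl lerD2l -mulrA -[leRHS]mulr1 ler_pM2l// mulrC.
by rewrite ler_pdivrMr// mul1r lerDl.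
Qed.
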